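(* Let $\mathcal{P}=\langle\Sigma\mid\mathcal{R}\rangle$ be a semigroup presentation and $w\in\Sigma^+$ a base word. If the Squier complex $S(\mathcal{P},w)$ is special, then the morphism $\Phi=\Phi(\mathcal{P},w):D(\mathcal{P},w)\to A(\mathcal{P},w)$ is injective.
   Context: A semigroup presentation $\mathcal{P}=\langle\Sigma\mid\mathcal{R}\rangle$ consists of an alphabet $\Sigma$ and a set $\mathcal{R}$ of relations $u=v$ with $u,v\in\Sigma^+$. Here $\Sigma^+$ is the free semigroup of non-empty words and $\Sigma^*=\Sigma^+\cup\{1\}$ also contains the empty word $1$. Convention: if $u=v\in\mathcal{R}$ then $v=u\notin\mathcal{R}$ (in particular $u=u\notin\mathcal{R}$). The Squier complex $S(\mathcal{P})$ is the cube complex whose vertices are the words over $\Sigma$; whose oriented edges are $(a,u\to v,b)$ with $a,b\in\Sigma^*$ and $u=v$ or $v=u$ in $\mathcal{R}$, going from $aub$ to $avb$ (and $(a,v\to u,b)$ is the same edge with opposite orientation); and whose $n$-cubes are similarly $(a_1,u_1\to v_1,\dots,a_n,u_n\to v_n,a_{n+1})$, spanned by the vertices $a_1w_1\cdots a_nw_na_{n+1}$ with $w_i\in\{u_i,v_i\}$. $S(\mathcal{P},w)$ is the connected component containing $w$; it is nonpositively curved. The diagram group is $D(\mathcal{P},w)=\pi_1(S(\mathcal{P},w),w)$. A hyperplane is an equivalence class of edges for the equivalence relation generated by: two edges are equivalent if they are parallel sides of some square; oriented hyperplanes $\vec J$ are defined likewise with oriented edges, $-\vec J$ being the opposite orientation.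 $[a,u\to v,b]$ is the hyperplane dual to (containing) the edge $(a,u\to v,b)$. $J$ is 2-sided if $\vec J\neq-\vec J$ (every hyperplane of $S(\mathcal{P})$ is 2-sided); self-intersecting if two edges dual to $J$ are non-parallel sides of some square; self-osculating if there are two oriented edges dual to $\vec J$ with the same initial points or the same terminal points but not belonging to a same square; clean if 2-sided, not self-intersecting and not self-osculating. Two hyperplanes are transverse (intersect) if edges dual to them, respectively, are non-parallel sides of some square; inter-osculating if they are transverse and there are edges dual to them, respectively, with a common endpoint but not belonging to a same square. The complex is special if its hyperplanes are clean and no two are inter-osculating. $A(\mathcal{P},w)$ is the right-angled Artin group $A(\Gamma(\mathcal{P},w))=\langle v\in V\mid [u,v]=1,\ (u,v)\in E\rangle$, where the graph $\Gamma(\mathcal{P},w)$ has as vertex set $V$ the (unoriented) hyperplanes of $S(\mathcal{P},w)$ and as edges $E$ the pairs of distinct intersecting hyperplanes. Fix an orientation of each hyperplane, hence of the edges of $S(\mathcal{P},w)$ (consistently along hyperplanes). Sending each positive edge $(a,u\to v,b)$ to $[a,u\to v,b]$ and each negative edge $(a,u\to v,b)$ to $[a,u\to v,b]^{-1}$ induces a morphism $\Phi:\pi_1(S(\mathcal{P},w),w)=D(\mathcal{P},w)\to A(\mathcal{P},w)$.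
   Formalization: In the definitions of self-osculating and inter-osculating, ''not belonging to a same square'' is read as ''not spanning a corner of a square at the common endpoint'' (the standard notion); under the literal reading, where any common square suffices, the claim is false. *)

(* Defs.v *)
From HB Require Import structures.
From Stdlib Require Import Relations.
From mathcomp Require Import all_boot.
From mathcomp Require Import monoid generic_quotient boolp.

Set Implicit Arguments.
Unset Strict Implicit.
Unset Printing Implicit Defensive.

Local Open Scope quotient_scope.

Section GeneratedQuotient.
Variables (T : Type) (R : T -> T -> Prop).

Definition gen_rel : rel {classic T} :=
  fun x y => `[< clos_refl_sym_trans T R x y >].

Lemma gen_rel_equiv : equiv_class_of gen_rel.
Proof.
split=> [x|x y|y x z].
- by apply/asboolP/rst_refl.
- by apply/asboolP/asboolP; apply: rst_sym.
- by move=> /asboolP xy /asboolP yz; apply/asboolP/(rst_trans _ _ _ y).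
Qed.

Canonical gen_equiv := EquivRelPack gen_rel_equiv.

Definition gen_quot := {eq_quot gen_equiv}.

Definition qclass (x : T) : gen_quot := \pi_gen_quot (x : {classic T}).
Definition qrepr (c : gen_quot) : T := repr c.

Lemma qreprK (c : gen_quot) : qclass (qrepr c) = c.
Proof. exact: reprK. Qed.

Lemma qclassP (x y : T) :
  qclass x = qclass y <-> clos_refl_sym_trans T R x y.
Proof.
split=> [/eqmodP/asboolP //|xy].
by apply/eqmodP/asboolP.
Qed.

End GeneratedQuotient.

Record word_group := WordGroup {
  wg_sort : Type;
  wg_move : wg_sort -> wg_sort -> Prop;
  wg_one : wg_sort;
  wg_mul : wg_sort -> wg_sort -> wg_sort;
  wg_inv : wg_sort -> wg_sort;
  wg_mulA : associative wg_mul;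
  wg_mul1 : left_id wg_one wg_mul;
  wg_1mul : right_id wg_one wg_mul;
  wg_moveMl : forall z x y, wg_move x y -> wg_move (wg_mul z x) (wg_mul z y);
  wg_moveMr : forall z x y, wg_move x y -> wg_move (wg_mul x z) (wg_mul y z);
  wg_mulV : forall x,
    clos_refl_sym_trans _ wg_move (wg_mul x (wg_inv x)) wg_one;
  wg_Vmul : forall x,
    clos_refl_sym_trans _ wg_move (wg_mul (wg_inv x) x) wg_one }.

Definition quot_group (G : word_group) : Type := gen_quot (@wg_move G).

HB.instance Definition _ (G : word_group) := Choice.on (quot_group G).

Section QuotGroup.
Variable G : word_group.
Implicit Types x y z : wg_sort G.

Definition wclass x : quot_group G := qclass (@wg_move G) x.

Definition quot_one : quot_group G := wclass (wg_one G).
Definition quot_mul (a b : quot_group G) : quot_group G :=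
  wclass (wg_mul (qrepr a) (qrepr b)).
Definition quot_inv (a : quot_group G) : quot_group G :=
  wclass (wg_inv (qrepr a)).

Let eqv x y := clos_refl_sym_trans _ (@wg_move G) x y.

Let eqvMl z x y : eqv x y -> eqv (wg_mul z x) (wg_mul z y).
Proof.
elim=> [{}x {}y /(wg_moveMl z)|{}x|{}x {}y _|{}x {}y t _ xy _ yt].
- exact: rst_step.
- exact: rst_refl.
- exact: rst_sym.
- exact: rst_trans xy yt.
Qed.

Let eqvMr z x y : eqv x y -> eqv (wg_mul x z) (wg_mul y z).
Proof.
elim=> [{}x {}y /(wg_moveMr z)|{}x|{}x {}y _|{}x {}y t _ xy _ yt].
- exact: rst_step.
- exact: rst_refl.
- exact: rst_sym.
- exact: rst_trans xy yt.
Qed.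

Let eqv_repr x : eqv (qrepr (wclass x)) x.
Proof. by apply/qclassP; rewrite qreprK. Qed.

Lemma quot_mulE x y : quot_mul (wclass x) (wclass y) = wclass (wg_mul x y).
Proof.
apply/qclassP; apply: rst_trans (eqvMl _ (eqv_repr y)).
exact/eqvMr/eqv_repr.
Qed.

Let quotW (P : quot_group G -> Prop) :
  (forall x, P (wclass x)) -> forall a, P a.
Proof. by move=> Px a; rewrite -(qreprK a); exact: Px. Qed.

Let quot_mulA : associative quot_mul.
Proof.
elim/quotW=> x; elim/quotW=> y; elim/quotW=> z.
by rewrite !quot_mulE wg_mulA.
Qed.

Let quot_mul1 : left_id quot_one quot_mul.
Proof. by elim/quotW=> x; rewrite quot_mulE wg_mul1. Qed.

Let quot_1mul : right_id quot_one quot_mul.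
Proof. by elim/quotW=> x; rewrite quot_mulE wg_1mul. Qed.

Let quot_Vmul : left_inverse quot_one quot_inv quot_mul.
Proof.
move=> a; rewrite -[X in quot_mul _ X](qreprK a) quot_mulE.
exact/qclassP/wg_Vmul.
Qed.

Let quot_mulV : right_inverse quot_one quot_inv quot_mul.
Proof.
move=> a; rewrite -[X in quot_mul X _](qreprK a) quot_mulE.
exact/qclassP/wg_mulV.
Qed.

HB.instance Definition _ := isGroup.Build (quot_group G)
  quot_mulA quot_mul1 quot_1mul quot_Vmul quot_mulV.

End QuotGroup.

Section Presentation.
Variables (V : Type) (relator : seq (V * bool) -> Prop).

(* The letter [(v, true)] stands for [v] and [(v, false)] for [v^-1]. *)
Definition letter_inv (l : V * bool) := (l.1, ~~ l.2).

Variant pres_move : seq (V * bool) -> seq (V * bool) -> Prop :=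
| PresFree s t l : pres_move (s ++ t) (s ++ [:: l; letter_inv l] ++ t)
| PresRel s t r of relator r : pres_move (s ++ t) (s ++ r ++ t).

Definition word_inv (s : seq (V * bool)) := rev (map letter_inv s).

Lemma letter_invK : involutive letter_inv.
Proof. by case=> v b; rewrite /letter_inv /= negbK. Qed.

Lemma pres_moveMl z x y : pres_move x y -> pres_move (z ++ x) (z ++ y).
Proof. by case=> [s t l|s t r rr]; rewrite !(catA z); constructor. Qed.

Lemma pres_moveMr z x y : pres_move x y -> pres_move (x ++ z) (y ++ z).
Proof. by case=> [s t l|s t r rr]; rewrite -!catA; constructor. Qed.

Lemma pres_mulV s :
  clos_refl_sym_trans _ pres_move (s ++ word_inv s) [::].
Proof.
elim/last_ind: s => [|s l IHs]; first exact: rst_refl.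
rewrite /word_inv map_rcons rev_rcons -cats1 -catA.
apply: rst_trans IHs; apply/rst_sym/rst_step.
exact: (PresFree s (word_inv s) l).
Qed.

Lemma word_invK : involutive word_inv.
Proof.
move=> s; rewrite /word_inv map_rev revK -map_comp -[RHS]map_id.
exact/eq_map/letter_invK.
Qed.

Lemma pres_Vmul s :
  clos_refl_sym_trans _ pres_move (word_inv s ++ s) [::].
Proof. by rewrite -{2}[s]word_invK; apply: pres_mulV. Qed.

Definition pres_word_group : word_group :=
  WordGroup (@catA _) (@cat0s _) (@cats0 _)
    pres_moveMl pres_moveMr pres_mulV pres_Vmul.

Definition pres_group : groupType := quot_group pres_word_group.

Definition pres_elt (s : seq (V * bool)) : pres_group :=
  @wclass pres_word_group s.

Lemma pres_elt_cat s t : pres_elt (s ++ t) = (pres_elt s * pres_elt t)%g.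
Proof. by symmetry; apply: (@quot_mulE pres_word_group). Qed.

Lemma pres_elt_free l : pres_elt [:: l; letter_inv l] = 1%g.
Proof. by apply/qclassP/rst_sym/rst_step; apply: (PresFree [::] [::]). Qed.

Lemma pres_elt_rel r : relator r -> pres_elt r = 1%g.
Proof.
move=> rr; apply/qclassP/rst_sym/rst_step.
by rewrite -[r]cats0; apply: (PresRel [::] [::]).
Qed.

End Presentation.

Definition commutator_relator (V : Type) (E : V -> V -> Prop)
    (r : seq (V * bool)) : Prop :=
  exists u v, E u v /\ r = [:: (u, true); (v, true); (u, false); (v, false)].

Definition raag (V : Type) (E : V -> V -> Prop) : groupType :=
  pres_group (commutator_relator E).

(* Only the 2-skeleton is recorded: hyperplanes, specialness and the
   fundamental group of a cube complex do not involve its higher cubes.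
   Edges are oriented.  [square e f e' f'] says that some square has [e] and
   [f] as the two sides issued from one of its corners, [e'] being the side
   parallel to [e] (issued from [tgt f]) and [f'] the one parallel to [f]
   (issued from [tgt e]). *)
Record cube_complex := CubeComplex {
  vertex : Type;
  edge : Type;
  src : edge -> vertex;
  einv : edge -> edge;
  square : edge -> edge -> edge -> edge -> Prop;
  einvK : involutive einv;
  einv_neq : forall e, einv e <> e;
  square_ends : forall e f e' f', square e f e' f' ->
    [/\ src f = src e, src e' = src (einv f), src f' = src (einv e)
      & src (einv e') = src (einv f')];
  square_sym : forall e f e' f', square e f e' f' -> square f e f' e';
  square_rot : forall e f e' f', square e f e' f' ->
    square (einv e) f' (einv e') f }.

Arguments src {c}.
Arguments einv {c}.
Arguments square {c}.

Definition tgt (X : cube_complex) (e : edge X) : vertex X := src (einv e).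

Section Paths.
Variable X : cube_complex.

Fixpoint is_path (x : vertex X) (p : seq (edge X)) (y : vertex X) : Prop :=
  if p is e :: p' then src e = x /\ is_path (tgt e) p' y else x = y.

Definition connected (x y : vertex X) : Prop := exists p, is_path x p y.

Definition path_inv (p : seq (edge X)) := rev (map einv p).

Lemma is_path_cat x y z p q :
  is_path x p y -> is_path y q z -> is_path x (p ++ q) z.
Proof.
elim: p x => [|e p IHp] x /=; first by move=> ->.
by case=> ex /IHp{}IHp /IHp.
Qed.

Lemma tgt_einv (e : edge X) : tgt (einv e) = src e.
Proof. by rewrite /tgt einvK. Qed.

Lemma is_path_inv x y p : is_path x p y -> is_path y (path_inv p) x.
Proof.
elim: p x => [|e p IHp] x /=; first by move=> ->.
case=> <- /IHp{}IHp; rewrite /path_inv /= rev_cons -cats1.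
by apply: is_path_cat IHp _ => /=; split; last exact: tgt_einv.
Qed.

Lemma path_invK : involutive path_inv.
Proof.
move=> s; rewrite /path_inv map_rev revK -map_comp -[RHS]map_id.
exact/eq_map/einvK.
Qed.

End Paths.

Section Component.
Variables (X : cube_complex) (x0 : vertex X).

Let cvertex := {x : vertex X | connected x0 x}.
Let cedge := {e : edge X | connected x0 (src e)}.

Lemma connected_einv (e : edge X) :
  connected x0 (src e) -> connected x0 (src (einv e)).
Proof.
case=> p pP; exists (p ++ [:: e]).
by apply: is_path_cat pP _.
Qed.

Definition component_src (e : cedge) : cvertex :=
  exist _ (src (sval e)) (svalP e).

Definition component_einv (e : cedge) : cedge :=
  exist (fun e => connected x0 (src e))
    (einv (sval e)) (connected_einv (svalP e)).

Definition component_square (e f e' f' : cedge) : Prop :=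
  square (sval e) (sval f) (sval e') (sval f').

Lemma component_einvK : involutive component_einv.
Proof. by case=> e ec; apply: eq_exist; apply: einvK. Qed.

Lemma component_einv_neq e : component_einv e <> e.
Proof. by move=> /(congr1 sval) /einv_neq. Qed.

Lemma component_square_ends e f e' f' : component_square e f e' f' ->
  [/\ component_src f = component_src e,
      component_src e' = component_src (component_einv f),
      component_src f' = component_src (component_einv e)
    & component_src (component_einv e') = component_src (component_einv f')].
Proof. by move=> /square_ends[? ? ? ?]; split; apply: eq_exist. Qed.

Lemma component_square_sym e f e' f' :
  component_square e f e' f' -> component_square f e f' e'.
Proof. exact: square_sym. Qed.

Lemma component_square_rot e f e' f' : component_square e f e' f' ->
  component_square (component_einv e) f' (component_einv e') f.
Proof. exact: square_rot. Qed.

Definition component : cube_complex :=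
  CubeComplex component_einvK component_einv_neq component_square_ends
    component_square_sym component_square_rot.

Definition component_base : vertex component :=
  exist _ x0 (ex_intro _ [::] (erefl x0)).

End Component.

Section FundamentalGroup.
Variables (X : cube_complex) (x0 : vertex X).

Variant homotopy_move : seq (edge X) -> seq (edge X) -> Prop :=
| HomotopyBacktrack p q e :
    homotopy_move (p ++ q) (p ++ [:: e; einv e] ++ q)
| HomotopySquare p q e f e' f' of square e f e' f' :
    homotopy_move (p ++ [:: e; f'] ++ q) (p ++ [:: f; e'] ++ q).

Definition loop := {p : seq (edge X) | is_path x0 p x0}.

Definition loop_move (p q : loop) : Prop := homotopy_move (sval p) (sval q).

Definition loop_one : loop := exist _ [::] (erefl x0).
Definition loop_mul (p q : loop) : loop :=
  exist _ (sval p ++ sval q) (is_path_cat (svalP p) (svalP q)).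
Definition loop_inv (p : loop) : loop :=
  exist _ (path_inv (sval p)) (is_path_inv (svalP p)).

Lemma loop_mulA : associative loop_mul.
Proof. by move=> p q r; apply: eq_exist; apply: catA. Qed.

Lemma loop_mul1 : left_id loop_one loop_mul.
Proof. by case=> p pP; apply: eq_exist. Qed.

Lemma loop_1mul : right_id loop_one loop_mul.
Proof. by case=> p pP; apply: eq_exist; apply: cats0. Qed.

Lemma loop_moveMl r p q :
  loop_move p q -> loop_move (loop_mul r p) (loop_mul r q).
Proof.
rewrite /loop_move /=.
by case=> [s t e|s t e f e' f' sq]; rewrite !(catA (sval r)); constructor.
Qed.

Lemma loop_moveMr r p q :
  loop_move p q -> loop_move (loop_mul p r) (loop_mul q r).
Proof.
rewrite /loop_move /=.
case=> [s t e|s t e f e' f' sq]; rewrite -!catA; first exact: HomotopyBacktrack.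
by apply: HomotopySquare.
Qed.

Let loop_eqv := clos_refl_sym_trans _ loop_move.

Lemma loop_cancel y p (pP : is_path x0 p y)
    (ppP : is_path x0 (p ++ path_inv p) x0) :
  loop_eqv (exist _ (p ++ path_inv p) ppP) loop_one.
Proof.
elim/last_ind: p y pP ppP => [|p e IHp] y.
  move=> _ ppP; suff -> : exist _ [::] ppP = loop_one by apply: rst_refl.
  exact: eq_exist.
rewrite -cats1 => peP ppP.
have [z pP] : exists z, is_path x0 p z.
  elim: p (x0) peP {IHp ppP} => [|e' p IHp] x /=; first by exists x.
  by case=> e'x /IHp[z zP]; exists z.
have pP' := is_path_cat pP (is_path_inv pP).
apply: rst_trans (IHp z pP pP'); apply/rst_sym/rst_step; rewrite /loop_move /=.
rewrite /path_inv map_cat rev_cat -catA /=.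
exact: (HomotopyBacktrack p (path_inv p) e).
Qed.

Lemma loop_mulV p : loop_eqv (loop_mul p (loop_inv p)) loop_one.
Proof. by case: p => p pP; apply: loop_cancel pP _. Qed.

Lemma loop_invK : involutive loop_inv.
Proof. by case=> p pP; apply: eq_exist; apply: path_invK. Qed.

Lemma loop_Vmul p : loop_eqv (loop_mul (loop_inv p) p) loop_one.
Proof. by rewrite -{2}[p]loop_invK; apply: loop_mulV. Qed.

Definition loop_word_group : word_group :=
  WordGroup loop_mulA loop_mul1 loop_1mul
    loop_moveMl loop_moveMr loop_mulV loop_Vmul.

Definition pi1 : groupType := quot_group loop_word_group.

Definition loop_class (p : loop) : pi1 := @wclass loop_word_group p.

End FundamentalGroup.

Section Hyperplanes.
Variable X : cube_complex.
Implicit Types e f : edge X.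

Definition parallel e e' : Prop := exists f f', square e f e' f'.

Lemma parallel_sym e e' : parallel e e' -> parallel e' e.
Proof.
case=> f [f' sq]; exists (einv f), (einv f').
exact/square_sym/square_rot/square_sym.
Qed.

(* Unoriented edges are pairs [{e, einv e}]. *)
Definition hyperplane : Type :=
  gen_quot (fun e e' => e' = einv e \/ parallel e e').
Definition oriented_hyperplane : Type := gen_quot parallel.

Definition hyp e : hyperplane := qclass _ e.
Definition ohyp e : oriented_hyperplane := qclass _ e.

Implicit Types J H : hyperplane.

Definition two_sided J : Prop := forall e, hyp e = J -> ohyp e <> ohyp (einv e).

Definition transverse J H : Prop :=
  exists e f e' f', [/\ square e f e' f', hyp e = J & hyp f = H].

Definition self_intersecting J : Prop := transverse J J.

Definition span_corner e f : Prop := exists e' f', square e f e' f'.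

(* A square of a Squier complex may have two opposite corners at the same
   vertex.  As usual for special cube complexes, two edges meeting at a vertex
   are considered to belong to a same square only if they form a corner of a
   square there: it is not enough that they form a corner of some square at
   another vertex they have in common.  The distinction matters: with the
   weaker requirement, the Squier complex of
   <x, y, b, s, p, z | xy = xybs, y = ybs, p = sbp, pz = sbpz> at xybpz would
   count as special although the morphism [Phi] below is not injective. *)
Definition osculate_at_source e f : Prop :=
  [/\ e <> f, src e = src f & ~ span_corner e f].

Definition self_osculating J : Prop :=
  exists e f, [/\ hyp e = J, ohyp e = ohyp f
    & osculate_at_source e f \/ osculate_at_source (einv e) (einv f)].

Definition clean J : Prop :=
  [/\ two_sided J, ~ self_intersecting J & ~ self_osculating J].

Definition inter_osculating J H : Prop :=
  transverse J H /\
  exists e f, [/\ hyp e = J, hyp f = H & osculate_at_source e f].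

Definition special : Prop :=
  (forall J, clean J) /\ (forall J H, J <> H -> ~ inter_osculating J H).

(* A choice, for each hyperplane, of one of its orientations. *)
Record orientation := Orientation {
  positive : edge X -> bool;
  positive_einv : forall e, positive (einv e) = ~~ positive e;
  positive_parallel : forall e e', parallel e e' -> positive e = positive e' }.

Definition crossing J H : Prop := J <> H /\ transverse J H.

End Hyperplanes.

Section Label.
Variables (X : cube_complex) (o : orientation X) (x0 : vertex X).

Let A : groupType := raag (@crossing X).

Definition label (e : edge X) : hyperplane X * bool := (hyp e, positive o e).

Definition word_label (p : seq (edge X)) : A :=
  pres_elt (commutator_relator (@crossing X)) (map label p).

Definition label_morphism (g : pi1 x0) : A :=
  word_label (sval (qrepr g : loop x0)).

Local Open Scope group_scope.

Lemma word_label_cat p q : word_label (p ++ q) = word_label p * word_label q.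
Proof. by rewrite /word_label map_cat pres_elt_cat. Qed.

Lemma label_einv e : label (einv e) = letter_inv (label e).
Proof.
rewrite /label /letter_inv positive_einv /=; congr pair.
by apply/qclassP/rst_sym/rst_step; left.
Qed.

Lemma word_label_einv e : word_label [:: e; einv e] = 1.
Proof. by rewrite /word_label /= label_einv pres_elt_free. Qed.

Lemma label_parallel e e' : parallel e e' -> label e = label e'.
Proof.
move=> ee'; rewrite /label (positive_parallel o ee'); congr pair.
by apply/qclassP/rst_step; right.
Qed.

Lemma commute_letters (u v : hyperplane X) b c : u = v \/ crossing u v ->
  commute (pres_elt (commutator_relator (@crossing X)) [:: (u, b)])
          (pres_elt (commutator_relator (@crossing X)) [:: (v, c)]).
Proof.
move=> uv; pose el l : A := pres_elt (commutator_relator (@crossing X)) [:: l].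
have elV l : el (letter_inv l) = (el l)^-1.
  by apply: (mulgI (el l)); rewrite mulgV -pres_elt_cat pres_elt_free.
have comm : commute (el (u, true)) (el (v, true)).
  case: uv => [->|uv]; first by [].
  have : el (u, true) * el (v, true) * el (u, false) * el (v, false) = 1.
    pose s := [:: (u, true); (v, true); (u, false); (v, false)].
    have <- : pres_elt (commutator_relator (@crossing X)) s = 1.
      by apply: pres_elt_rel; exists u, v.
    rewrite /el -(pres_elt_cat _ [:: _] [:: _]).
    rewrite -(pres_elt_cat _ [:: _; _] [:: _]).
    by rewrite -(pres_elt_cat _ [:: _; _; _] [:: _]).
  rewrite (elV (u, true)) (elV (v, true)) => uv1.
  by apply: (mulIg (el (u, true))^-1); apply: (mulIg (el (v, true))^-1);
    rewrite uv1 mulgK mulgV.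
rewrite -/(el (u, b)) -/(el (v, c)).
case: b; case: c; rewrite ?(elV (u, true)) ?(elV (v, true)) //.
- exact: commuteV.
- exact/commute_sym/commuteV/commute_sym.
- exact/commuteV/commute_sym/commuteV/commute_sym.
Qed.

Lemma word_label_move p q : homotopy_move p q -> word_label p = word_label q.
Proof.
case=> {p q} [p q e|p q e f e' f' sq]; rewrite !word_label_cat.
  by rewrite word_label_einv mul1g.
congr (_ * (_ * _)).
have ee' : label e = label e' by apply: label_parallel; exists f, f'.
have ff' : label f = label f'.
  by apply: label_parallel; exists e, e'; apply: square_sym.
rewrite -[[:: e; f']]/([:: e] ++ [:: f']) -[[:: f; e']]/([:: f] ++ [:: e']).
rewrite !word_label_cat /word_label /= -ee' -ff'.
apply: commute_letters; have [|ef] := pselect (hyp e = hyp f); first by left.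
by right; split=> //; exists e, f, e', f'.
Qed.

Lemma label_morphismE (p : loop x0) :
  label_morphism (loop_class p) = word_label (sval p).
Proof.
have : clos_refl_sym_trans _ (@loop_move X x0) (qrepr (loop_class p)) p.
  by apply/qclassP; rewrite qreprK.
rewrite /label_morphism; move: (qrepr _) => q.
elim=> {p q} [p q pq|//|p q _ ->//|p q r _ -> _ ->//].
exact: word_label_move.
Qed.

Lemma label_morphismM : {morph label_morphism : g h / g * h}.
Proof.
move=> g h; rewrite -(qreprK g) -(qreprK h).
rewrite -[qclass _ (qrepr g)]/(loop_class (qrepr g)).
rewrite -[qclass _ (qrepr h)]/(loop_class (qrepr h)).
rewrite [_ * _]quot_mulE !label_morphismE /=.
exact: word_label_cat.
Qed.

Lemma label_morphism1 : label_morphism 1 = 1.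
Proof. exact: (label_morphismE (loop_one x0)). Qed.

HB.instance Definition _ := isUMagmaMorphism.Build (pi1 x0) A
  label_morphism (label_morphism1, label_morphismM).

End Label.

Record semigroup_presentation (Sigma : Type) := SemigroupPresentation {
  pres_relation : seq Sigma -> seq Sigma -> Prop;
  pres_relation_nonempty :
    forall u v, pres_relation u v -> u <> [::] /\ v <> [::];
  pres_relation_asym :
    forall u v, pres_relation u v -> ~ pres_relation v u }.

Section Squier.
Variables (Sigma : Type) (P : semigroup_presentation Sigma).

Record squier_edge := SquierEdge {
  eleft : seq Sigma;
  efrom : seq Sigma;
  eto : seq Sigma;
  eright : seq Sigma;
  erelation : pres_relation P efrom eto \/ pres_relation P eto efrom }.

Definition squier_src (e : squier_edge) := eleft e ++ efrom e ++ eright e.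

Definition squier_einv (e : squier_edge) :=
  @SquierEdge (eleft e) (eto e) (efrom e) (eright e) (iffLR (or_comm _ _) (erelation e)).

(* The two sides, issued from the corner [a u b p c], of the square
   [(a, u -> v, b, p -> q, c)]; the letters range over both orientations of
   each relation, so that every corner of every square is obtained. *)
Variant squier_square :
  squier_edge -> squier_edge -> squier_edge -> squier_edge -> Prop :=
| SquierSquare a u v b p q c uv pq :
    squier_square (@SquierEdge a u v (b ++ p ++ c) uv)
                  (@SquierEdge (a ++ u ++ b) p q c pq)
                  (@SquierEdge a u v (b ++ q ++ c) uv)
                  (@SquierEdge (a ++ v ++ b) p q c pq)
| SquierSquareSym a u v b p q c uv pq :
    squier_square (@SquierEdge (a ++ u ++ b) p q c pq)
                  (@SquierEdge a u v (b ++ p ++ c) uv)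
                  (@SquierEdge (a ++ v ++ b) p q c pq)
                  (@SquierEdge a u v (b ++ q ++ c) uv).

Lemma squier_einvK : involutive squier_einv.
Proof.
by case=> a u v b uv; rewrite /squier_einv /=; congr SquierEdge.
Qed.

Lemma squier_einv_neq e : squier_einv e <> e.
Proof.
case: e => a u v b uv [vu _]; rewrite {}vu in uv.
by case: uv => /[dup] /pres_relation_asym.
Qed.

Lemma squier_square_ends e f e' f' : squier_square e f e' f' ->
  [/\ squier_src f = squier_src e,
      squier_src e' = squier_src (squier_einv f),
      squier_src f' = squier_src (squier_einv e)
    & squier_src (squier_einv e') = squier_src (squier_einv f')].
Proof.
by case=> a u v b p q c uv pq; rewrite /squier_src /= -!catA.
Qed.

Lemma squier_square_sym e f e' f' :
  squier_square e f e' f' -> squier_square f e f' e'.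
Proof. by case=> *; constructor. Qed.

Lemma squier_square_rot e f e' f' : squier_square e f e' f' ->
  squier_square (squier_einv e) f' (squier_einv e') f.
Proof.
by case=> a u v b p q c uv pq; constructor.
Qed.

Definition squier_complex : cube_complex :=
  CubeComplex squier_einvK squier_einv_neq squier_square_ends
    squier_square_sym squier_square_rot.

Definition squier (w : seq Sigma) : cube_complex :=
  @component squier_complex w.

Definition squier_base (w : seq Sigma) : vertex (squier w) :=
  @component_base squier_complex w.

Definition diagram_group (w : seq Sigma) : groupType := pi1 (squier_base w).

Definition diagram_artin_group (w : seq Sigma) : groupType :=
  raag (@crossing (squier w)).

Definition Phi (w : seq Sigma) (o : orientation (squier w)) :
    {multiplicative diagram_group w -> diagram_artin_group w} :=
  label_morphism o (x0 := squier_base w).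

Definition squier_positive (w : seq Sigma) (e : edge (squier w)) : bool :=
  `[< pres_relation P (efrom (sval e)) (eto (sval e)) >].

Lemma squier_positive_einv w (e : edge (squier w)) :
  squier_positive (einv e) = ~~ squier_positive e.
Proof.
case: e => -[a u v b uv] ec; rewrite /squier_positive /=.
apply/asboolP/asboolPn => [vu /pres_relation_asym//|nuv].
by case: uv ec nuv.
Qed.

Lemma squier_positive_parallel w (e e' : edge (squier w)) :
  parallel e e' -> squier_positive e = squier_positive e'.
Proof.
case=> f [f']; rewrite /squier_positive => /= sq.
by case: sq.
Qed.

Definition squier_orientation (w : seq Sigma) : orientation (squier w) :=
  Orientation (@squier_positive_einv w) (@squier_positive_parallel w).

End Squier.

(* Main.v *)
(** A word in the generators of a right-angled Artin group represents [1]
    only if it can be turned into the empty word by exchanging adjacent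
    commuting letters and deleting adjacent inverse letters: no insertion is
    needed.  In a special complex, both operations on the label of a path lift
    to homotopies of the path: absence of inter-osculation provides the square
    needed for an exchange, and cleanness forces two consecutive edges with
    inverse labels to be a backtrack.  So a loop whose label is trivial is
    null-homotopic. *)
Require Import Defs.
From Stdlib Require Import Relations.
From mathcomp Require Import all_boot monoid boolp.

Set Implicit Arguments.
Unset Strict Implicit.
Unset Printing Implicit Defensive.

Lemma map_eq_cons (S T : Type) (h : S -> T) (p : seq S) (y : T) (s : seq T) :
  map h p = y :: s -> exists a q, [/\ p = a :: q, h a = y & map h q = s].
Proof. by case: p => // a p [<- <-]; exists a, p. Qed.

Section ArtinWords.
Variables (V : Type) (E : V -> V -> Prop).
Hypotheses (Eirr : forall v, ~ E v v) (Esym : forall u v, E u v -> E v u).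
Implicit Types (k l x y : V * bool) (s t : seq (V * bool)).

Inductive shuffle_step : seq (V * bool) -> seq (V * bool) -> Prop :=
| ShuffleCancel l s : shuffle_step (l :: letter_inv l :: s) s
| ShuffleSwap x y s of E x.1 y.1 : shuffle_step (x :: y :: s) (y :: x :: s)
| ShuffleCons x s t of shuffle_step s t : shuffle_step (x :: s) (x :: t).

Definition shuffles := clos_refl_trans_1n _ shuffle_step.

Lemma shuffles_trans s t r : shuffles s t -> shuffles t r -> shuffles s r.
Proof.
by elim=> // a b c ab _ IH /IH; apply: Relation_Operators.rt1n_trans.
Qed.

Lemma shuffles_step s t : shuffle_step s t -> shuffles s t.
Proof.
by move=> st; apply: Relation_Operators.rt1n_trans st _; apply: rt1n_refl.
Qed.

Lemma shuffles_cons x s t : shuffles s t -> shuffles (x :: s) (x :: t).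
Proof.
elim=> [a|a b c ab _]; first exact: rt1n_refl.
by apply: Relation_Operators.rt1n_trans; apply: ShuffleCons.
Qed.

Lemma shuffles_cat a s t : shuffles s t -> shuffles (a ++ s) (a ++ t).
Proof. by elim: a => //= x a IH /IH; apply: shuffles_cons. Qed.

(* [extract k s t]: [s = m k b] and [t = m b], all letters of [m] commuting
   with [k]. *)
Inductive extract k : seq (V * bool) -> seq (V * bool) -> Prop :=
| ExtractHere s : extract k (k :: s) s
| ExtractCons x s t of E x.1 k.1 & extract k s t :
    extract k (x :: s) (x :: t).

(* [remove_pair s t]: [s = a l m l^-1 b] and [t = a m b], all letters of [m]
   commuting with [l].  Unlike the deletion of two adjacent letters, this is
   stable under exchanges. *)
Inductive remove_pair : seq (V * bool) -> seq (V * bool) -> Prop :=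
| RemoveHere l s t of extract (letter_inv l) s t : remove_pair (l :: s) t
| RemoveCons x s t of remove_pair s t : remove_pair (x :: s) (x :: t).

Lemma extract_cons_inv k x s t : extract k (x :: s) t ->
  (x = k /\ t = s) \/
  exists t', [/\ E x.1 k.1, extract k s t' & t = x :: t'].
Proof.
by move=> ex; inversion ex as [|? ? t' xk ex']; subst; [left|right; exists t'].
Qed.

Lemma remove_pair_cons_inv x s t : remove_pair (x :: s) t ->
  extract (letter_inv x) s t \/ exists2 t', remove_pair s t' & t = x :: t'.
Proof.
by move=> rp; inversion rp as [|? ? t']; subst; [left|right; exists t'].
Qed.

Lemma extract_shuffles k s t : extract k s t -> shuffles (k :: t) s.
Proof.
elim=> [{}s|x {}s {}t xk _ IH]; first exact: rt1n_refl.
apply: Relation_Operators.rt1n_trans (shuffles_cons x IH).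
exact/ShuffleSwap/Esym.
Qed.

Lemma extract_step k s t s' : extract k s t -> shuffle_step s s' ->
  (exists2 t', extract k s' t' & shuffles t t') \/
  shuffles t (letter_inv k :: s').
Proof.
move=> + st; elim: st k t => {s s'} [l s|x y s xy|x s s' ss' IH] k t.
- case/extract_cons_inv=> [[-> ->]|[t1 [xk + ->]]].
    by right; apply: rt1n_refl.
  case/extract_cons_inv=> [[lk _]|[t2 [xk' ex2 ->]]].
    by case: (@Eirr l.1); rewrite -{2}[l.1]/((letter_inv l).1) lk.
  by left; exists t2 => //; apply/shuffles_step/ShuffleCancel.
- case/extract_cons_inv=> [[xk ->]|[t1 [xk ex1 ->]]]; left.
    exists (y :: s); last exact: rt1n_refl.
    by rewrite -xk; apply: ExtractCons; [apply: Esym|apply: ExtractHere].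
  case/extract_cons_inv: ex1 => [[yk ->]|[t2 [yk ex2 ->]]].
    by exists (x :: s); [rewrite yk; apply: ExtractHere|apply: rt1n_refl].
  exists (y :: x :: t2); first by do 2!apply: ExtractCons => //.
  exact/shuffles_step/ShuffleSwap.
- case/extract_cons_inv=> [[-> ->]|[t1 [xk + ->]]].
    by left; exists s'; [apply: ExtractHere|apply: shuffles_step].
  case/IH=> [[t' ext' tt']|tt'].
    by left; exists (x :: t'); [apply: ExtractCons|apply: shuffles_cons].
  right; apply: shuffles_trans (shuffles_cons x tt') _.
  exact/shuffles_step/ShuffleSwap.
Qed.

Lemma remove_pair_step s t s' : remove_pair s t -> shuffle_step s s' ->
  exists2 t', shuffles t t' & t' = s' \/ remove_pair s' t'.
Proof.
move=> + st; elim: st t => {s s'} [l s|x y s xy|x s s' ss' IH] t.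
- case/remove_pair_cons_inv=> [|[t1 + ->]].
    case/extract_cons_inv=> [[_ ->]|[? [/Eirr]]] //.
    by exists s; [apply: rt1n_refl|left].
  case/remove_pair_cons_inv=> [|[t2 rp2 ->]].
    rewrite (letter_invK l) => ex.
    by exists s; [apply: extract_shuffles|left].
  by exists t2; [apply/shuffles_step/ShuffleCancel|right].
- case/remove_pair_cons_inv=> [|[t1 + ->]].
    case/extract_cons_inv=> [[yx _]|[t1 [yx ex1 ->]]].
      by case: (@Eirr x.1); rewrite yx in xy.
    exists (y :: t1); first exact: rt1n_refl.
    by right; apply/RemoveCons/RemoveHere.
  case/remove_pair_cons_inv=> [ex|[t2 rp2 ->]].
    exists (x :: t1); first exact: rt1n_refl.
    by right; apply/RemoveHere/ExtractCons.
  exists (y :: x :: t2); first exact/shuffles_step/ShuffleSwap.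
  by right; do 2!apply: RemoveCons.
- case/remove_pair_cons_inv=> [ex|[t1 rp1 ->]].
    case: (extract_step ex ss') => [[t' ext' tt']|].
      by exists t' => //; right; apply: RemoveHere.
    by rewrite letter_invK => tt'; exists (x :: s') => //; left.
  case: (IH _ rp1) => t' tt' rp'; exists (x :: t'); first exact: shuffles_cons.
  by case: rp' => [->|rp']; [left|right; apply: RemoveCons].
Qed.

Lemma remove_pair_nil s t :
  remove_pair s t -> shuffles s [::] -> shuffles t [::].
Proof.
move=> + sn; move En: [::] sn t => n sn.
elim: sn En => [r <- t rp|r r' q rr' r'q IH qn t rp]; first by inversion rp.
have [t' tt' t'r'] := remove_pair_step rp rr'.
apply: shuffles_trans tt' _.
by case: t'r' => [->|/(IH qn)].
Qed.

Lemma cancel_nil s t l :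
  shuffles (s ++ l :: letter_inv l :: t) [::] <-> shuffles (s ++ t) [::].
Proof.
split; last first.
  by apply: Relation_Operators.rt1n_trans; elim: s => [|x s IH] /=; constructor.
by apply: remove_pair_nil; elim: s => [|x s IH] /=; do 2?constructor.
Qed.

Lemma swap_nil s t x y : E x.1 y.1 ->
  shuffles (s ++ x :: y :: t) [::] <-> shuffles (s ++ y :: x :: t) [::].
Proof.
by move=> xy; split; apply: shuffles_trans;
  apply/shuffles_cat/shuffles_step/ShuffleSwap => //; apply: Esym.
Qed.

Lemma pres_move_nil s t : pres_move (commutator_relator E) s t ->
  shuffles s [::] <-> shuffles t [::].
Proof.
case=> {}s {}t; first by move=> l; rewrite cancel_nil.
move=> _ [u [v [uv ->]]] /=.
rewrite -cat_rcons (@swap_nil _ _ (v, true) (u, false) (Esym uv)) cat_rcons.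
by rewrite (cancel_nil _ _ (u, true)) (cancel_nil _ _ (v, true)).
Qed.

Lemma raag_trivial_shuffles s :
  pres_elt (commutator_relator E) s = 1%g -> shuffles s [::].
Proof.
move=> /qclassP s1; pose N r := shuffles r [::].
have N_rst a b : clos_refl_sym_trans _ (pres_move (commutator_relator E)) a b ->
    N a <-> N b.
  elim=> {a b} [x y|x|x y _ xy|x y z _ xy _ yz] //; first exact: pres_move_nil.
  - exact: iff_sym.
  - exact: iff_trans yz.
by apply/(N_rst _ _ s1)/rt1n_refl.
Qed.

End ArtinWords.

Section SpecialComplex.
Variables (X : cube_complex) (o : orientation X).
Hypothesis X_special : special X.
Implicit Types (e f : edge X) (p q : seq (edge X)) (x y : vertex X).

Lemma crossing_irr (J : hyperplane X) : ~ crossing J J.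
Proof. by case. Qed.

Lemma crossing_sym (J H : hyperplane X) : crossing J H -> crossing H J.
Proof.
case=> JH [e [f [e' [f' [/square_sym sq eJ fH]]]]].
by split; [exact: nesym|exists f, e, f', e'].
Qed.

Lemma hyp_einv e : hyp (einv e) = hyp e.
Proof. by apply/qclassP/rst_sym/rst_step; left. Qed.

Lemma ohyp_einv e f : ohyp e = ohyp f -> ohyp (einv e) = ohyp (einv f).
Proof.
move=> /qclassP ef; apply/qclassP; elim: ef => [a b|a|a b _|a b c _ ab _].
- by case=> g [g' /square_rot sq]; apply: rst_step; exists g', g.
- exact: rst_refl.
- exact: rst_sym.
- exact: rst_trans ab.
Qed.

Lemma ohyp_label e f : label o e = label o f -> ohyp e = ohyp f.
Proof.
rewrite /label => -[/qclassP ef].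
suff: ohyp e = ohyp (if positive o e == positive o f then f else einv f).
  by move=> + pef; rewrite pef eqxx.
elim: ef => {e f} [e f|e|e f _|e f g _ + _].
- case=> [->|ef]; first by rewrite positive_einv; case: positive => /=;
    rewrite einvK.
  by rewrite (positive_parallel o ef) eqxx; apply/qclassP/rst_step.
- by rewrite eqxx.
- rewrite [_ f == _]eq_sym; case: eqP => // _ /ohyp_einv.
  by rewrite einvK.
- case: (positive o e); case: (positive o f); case: (positive o g) => //= ->;
    by [|move/ohyp_einv|move/ohyp_einv; rewrite einvK].
Qed.

Lemma label_inverse_backtrack e f :
  src f = tgt e -> label o f = letter_inv (label o e) -> f = einv e.
Proof.
move=> fe; rewrite -label_einv => lfe; apply: contrapT => nfe.
have [_ nself nosc] := (proj1 X_special) (hyp f).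
apply: nosc; exists f, (einv e); split=> //; first exact: ohyp_label.
left; split=> // -[f' [e' sq]]; apply: nself; exists f, (einv e), f', e'.
by split=> //; case: lfe.
Qed.

Lemma crossing_square e f : src f = tgt e -> crossing (hyp e) (hyp f) ->
  exists g e', square e g e' f.
Proof.
move=> fe [nef tr].
have [[e' [g sq]]|nsq] := pselect (span_corner (einv e) f).
  by exists g, (einv e'); move: (square_rot sq); rewrite einvK.
case: (proj2 X_special _ _ nef); split=> //.
exists (einv e), f; split; [exact: hyp_einv|by []|split=> //].
by move=> ef; apply: nef; rewrite -ef hyp_einv.
Qed.

Lemma homotopy_move_cons e p q :
  homotopy_move p q -> homotopy_move (e :: p) (e :: q).
Proof.
case=> [s t f|s t a b a' b' sq]; rewrite -!cat_cons.
  exact: HomotopyBacktrack.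
exact: HomotopySquare.
Qed.

Lemma lift_shuffle_step x y p t :
  is_path x p y -> shuffle_step (@crossing X) (map (label o) p) t ->
  exists q, [/\ is_path x q y, map (label o) q = t
              & homotopy_move p q \/ homotopy_move q p].
Proof.
move=> + st; move ps: (map _ p) st => s st.
elim: s t / st x p ps => [l s|l k s lk|l s t st IH] x p' p's;
  have {p' p's} [e [p [-> le ps]]] := map_eq_cons p's.
- have [f [q [-> lf <-]]] := map_eq_cons ps; case=> [ex [fe qy]].
  have {}fe : f = einv e by apply: label_inverse_backtrack; rewrite ?lf ?le.
  exists q; split=> //; last first.
    by right; rewrite fe; apply: (HomotopyBacktrack [::]).
  by move: qy; rewrite fe tgt_einv ex.
- have [f [q [-> lf <-]]] := map_eq_cons ps; case=> [ex [fe qy]].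
  have [g [e' sq]] : exists g e', square e g e' f.
    by apply: crossing_square => //; move: lk; rewrite -le -lf.
  have [ge e'g _ e'f] := square_ends sq.
  exists [:: g, e' & q]; split.
  + by rewrite /= ge e'g /tgt e'f.
  + rewrite /= -le -lf; congr [:: _, _ & _]; apply/esym/label_parallel.
      by apply: parallel_sym; exists e, e'; apply: square_sym.
    by exists g, f.
  + by left; apply: (HomotopySquare [::]).
- case=> ex py; have [q [qy <- pq]] := IH _ p ps py.
  exists (e :: q); split=> //=; first by rewrite le.
  by case: pq => /(homotopy_move_cons e); [left|right].
Qed.

Lemma label_trivial_loop x (p : loop x) :
  word_label o (sval p) = 1%g -> loop_class p = 1%g.
Proof.
move=> /raag_trivial_shuffles pn; apply/qclassP.
move: {pn}(pn (@crossing_irr) (@crossing_sym)).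
move ps: (map _ _) => s; move En: [::] => n sn.
elim: s n / sn En p ps => [t <-|t t' r tt' _ IH /IH{}IH] [p pP] /= pt.
  by case: p pP pt => // pP _; rewrite [exist _ _ _](_ : _ = loop_one x);
    [apply: rst_refl|apply: eq_exist].
rewrite -pt in tt'; have [q [qP qt' pq]] := lift_shuffle_step pP tt'.
apply: rst_trans (IH (exist _ q qP) qt').
by case: pq => pq; [|apply: rst_sym]; apply: rst_step.
Qed.

Lemma special_label_injective x : injective (@label_morphism X o x).
Proof.
move=> g h gh; suff: (g * h^-1 = 1)%g by move/divg1_eq.
have : label_morphism o (g * h^-1)%g = 1%g.
  by rewrite label_morphismM gh -label_morphismM mulgV label_morphism1.
rewrite -(qreprK (g * h^-1)%g).
rewrite -[qclass _ (qrepr _)]/(loop_class (qrepr _)) label_morphismE.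
exact: label_trivial_loop.
Qed.

End SpecialComplex.

Theorem proposition3p16 (Sigma : Type) (P : semigroup_presentation Sigma)
  (w : seq Sigma) (w_nonempty : w <> [::])
  (o : orientation (squier P w))
  (S_special : special (squier P w)) :
  injective (Phi o).
Proof. exact: special_label_injective. Qed.
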